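(* Let $0<q<1$ and let $\Sigma$ be a random balanced permutation of $\mathbb Z$ distributed according to the Mallows measure $\mathcal Q$ with parameter $q$. For any fixed $j\in\mathbb Z$, the distribution of the displacement $D:=\Sigma(j)-j$ is given by $$\mathbb P(D=d)=(1-q)\,\langle\infty\rangle_q\sum_{\substack{r,\ell\ge 0\\ r-\ell=d}}\frac{q^{r\ell+r+\ell}}{\langle r\rangle_q\,\langle \ell\rangle_q},\qquad d\in\mathbb Z,$$ where the sum is over nonnegative integers $r,\ell$ with $r-\ell=d$.
   Context: Notation: $\langle n\rangle_q=\prod_{k=1}^n(1-q^k)$ for $n=0,1,2,\dots$ (with $\langle0\rangle_q=1$), $\langle\infty\rangle_q=\prod_{k=1}^\infty(1-q^k)$. $\mathfrak S$ is the group of all bijections of $\mathbb Z$, with the topology of pointwise convergence (for each $i$, $\sigma_n(i)=\sigma(i)$ for all large $n$) and its Borel structure. $\sigma\in\mathfrak S$ is balanced if $\#\{j\ge 1:\sigma(j)\le 0\}=\#\{j\le 0:\sigma(j)\ge 1\}<\infty$; $\mathfrak S^{\mathrm{bal}}$ is the group of balanced permutations. For $i\in\mathbb Z$ let $\sigma_{i,i+1}$ be the transposition swapping $i$ and $i+1$. A measure $\mu$ is right $q$-exchangeable if for every $i\in\mathbb Z$ its pushforward under $\sigma\mapsto\sigma\sigma_{i,i+1}$ is equivalent to $\mu$ with Radon–Nikodým derivative $q^{\mathrm{sgn}(\sigma(i+1)-\sigma(i))}$ at $\sigma$; it is left $q$-exchangeable if for every $i$ its pushforward under $\sigma\mapsto\sigma_{i,i+1}\sigma$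 is equivalent to $\mu$ with derivative $q^{\mathrm{sgn}(\sigma^{-1}(i+1)-\sigma^{-1}(i))}$. The Mallows measure $\mathcal Q$ is the unique (existing) Borel probability measure on $\mathfrak S^{\mathrm{bal}}$ that is both right and left $q$-exchangeable. *)

(* Defs.v *)
From HB Require Import structures.
From mathcomp Require Import all_boot all_order all_algebra finmap zify.
From mathcomp Require Import all_classical all_reals all_analysis.

Set Implicit Arguments.
Unset Strict Implicit.
Unset Printing Implicit Defensive.

Import Order.TTheory GRing.Theory Num.Theory.
Import numFieldNormedType.Exports.

Local Open Scope classical_set_scope.
Local Open Scope ring_scope.

(* [set_type] carries the subspace topology; the library does not fix a
   topology on [int], hence the explicit [discrete_topology]. *)
Definition permZ : Type :=
  [set f : {ptws int -> discrete_topology int} | bijective f].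

HB.instance Definition _ := Choice.on permZ.
HB.instance Definition _ := Topological.on permZ.

Definition permZ_fun (s : permZ) : int -> int := val s.
Coercion permZ_fun : permZ >-> Funclass.

Lemma permZ_bij (s : permZ) : bijective s.
Proof. exact: set_mem (valP s). Qed.

Definition mk_permZ (f : int -> int) (bf : bijective f) : permZ :=
  exist _ (f : {ptws int -> discrete_topology int}) (mem_set bf).

Lemma permZP (s t : permZ) : s =1 t -> s = t.
Proof. by move=> st; apply/val_inj/funext. Qed.

Section group.

Definition permZ_one : permZ := mk_permZ (Bijective (frefl id) (frefl id)).

Definition permZ_mul (s t : permZ) : permZ :=
  mk_permZ (bij_comp (permZ_bij s) (permZ_bij t)).

Lemma permZ_inv_ex (s : permZ) : exists t : permZ, cancel s t /\ cancel t s.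
Proof.
have [g sK gK] := permZ_bij s.
by exists (mk_permZ (Bijective gK sK)).
Qed.

Definition permZ_inv (s : permZ) : permZ := sval (cid (permZ_inv_ex s)).

Lemma permZ_funK (s : permZ) : cancel s (permZ_inv s).
Proof. exact: (svalP (cid (permZ_inv_ex s))).1. Qed.

Lemma permZ_funKV (s : permZ) : cancel (permZ_inv s) s.
Proof. exact: (svalP (cid (permZ_inv_ex s))).2. Qed.

Let mulA : associative permZ_mul. Proof. by move=> s t u; apply: permZP. Qed.
Let mul1 : left_id permZ_one permZ_mul.
Proof. by move=> s; apply: permZP. Qed.
Let mulr1 : right_id permZ_one permZ_mul.
Proof. by move=> s; apply: permZP. Qed.
Let mulV : left_inverse permZ_one permZ_inv permZ_mul.
Proof. by move=> s; apply: permZP => k; exact: permZ_funK. Qed.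
Let mulrV : right_inverse permZ_one permZ_inv permZ_mul.
Proof. by move=> s; apply: permZP => k; exact: permZ_funKV. Qed.

HB.instance Definition _ := isGroup.Build permZ mulA mul1 mulr1 mulV mulrV.

End group.

(* Unlike the product of [{perm T}], the product here composes right to left. *)
Lemma permZM (s t : permZ) (k : int) : (s * t : permZ)%g k = s (t k).
Proof. by []. Qed.

HB.instance Definition _ := isPointed.Build permZ permZ_one.

HB.instance Definition _ :=
  Measurable.copy permZ (g_sigma_algebraType (@open permZ)).

Definition swap_succ (i k : int) : int :=
  if k == i then i + 1 else if k == i + 1 then i else k.

Lemma swap_succK (i : int) : involutive (swap_succ i).
Proof.
move=> k; rewrite /swap_succ; have i1 : (i + 1 == i) = false by lia.
by do ![case: eqP => //=]; lia.
Qed.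

Definition transpZ (i : int) : permZ := mk_permZ (inv_bij (swap_succK i)).

Definition balanced : set permZ := [set s : permZ |
  [/\ finite_set [set j : int | 1 <= j /\ s j <= 0],
      finite_set [set j : int | j <= 0 /\ 1 <= s j]
    & ([set j : int | 1 <= j /\ s j <= 0]
         #= [set j : int | j <= 0 /\ 1 <= s j])%card]].

Lemma measurable_eval (i k : int) : measurable [set s : permZ | s i = k].
Proof.
apply: sub_sigma_algebra.
exists [set f : {ptws int -> discrete_topology int} | f i = k]; last by [].
apply: (@open_comp _ _ (fun f : {ptws int -> discrete_topology int} => f i)
  [set k : discrete_topology int]) => [f _|]; last exact: discrete_open.
exact: (@proj_continuous int (fun=> discrete_topology int) i).
Qed.

Lemma measurable_evalP (i : int) (B : set int) :
  measurable [set s : permZ | B (s i)].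
Proof.
have -> : [set s : permZ | B (s i)] =
    \bigcup_k (if k \in B then [set s : permZ | s i = k] else set0).
  apply/seteqP; split => [s Bs|s [k _]].
    by exists (s i) => //; rewrite ifT //; exact: mem_set.
  by case: ifPn => // /set_mem Bk /= ->.
apply: countable_bigcupT_measurable => // k.
by case: ifP => _ //; exact: measurable_eval.
Qed.

Lemma measurable_evals (B : int -> set int) :
  measurable [set s : permZ | forall i, B i (s i)].
Proof.
have -> : [set s : permZ | forall i, B i (s i)] =
    ~` \bigcup_i [set s : permZ | (~` B i) (s i)].
  apply/seteqP; split => [s Bs [i _]|s nBs i]; first exact.
  by apply: contrapT => nBi; apply: nBs; exists i.
apply: measurableC; apply: countable_bigcupT_measurable => // i.
exact: measurable_evalP.
Qed.

Lemma measurable_balanced : measurable balanced.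
Proof.
pose lo (s : permZ) := [set j : int | 1 <= j /\ s j <= 0].
pose hi (s : permZ) := [set j : int | j <= 0 /\ 1 <= s j].
have mE (C : permZ -> set int) (B : int -> set int) (F : {fset int}) :
    (forall s j, C s j <-> B j (s j)) -> measurable [set s | C s = [set` F]].
  move=> CB; rewrite (_ : mkset _ = [set s : permZ | forall j,
      [set k | B j k <-> j \in F] (s j)]).
    exact: (measurable_evals (fun j => [set k | B j k <-> j \in F])).
  apply/seteqP; split => [s /= CF j|s /= BF].
    by rewrite -CB CF.
  by apply/seteqP; split => j; rewrite CB BF.
have -> : balanced = \bigcup_(FG : {fset int} * {fset int})
    (if `[< ([set` FG.1] #= [set` FG.2])%card >] then
      [set s | lo s = [set` FG.1]] `&` [set s | hi s = [set` FG.2]] else set0).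
  apply/seteqP; split => [s [/finite_fsetP[F Fs] /finite_fsetP[G Gs] FG]|].
    exists (F, G) => //; case: asboolP => [_|]; first by split.
    by rewrite /= -Fs -Gs.
  move=> s [[F G] _]; case: asboolP => // FG [/= loE hiE].
  by rewrite /balanced /= -/(lo s) -/(hi s) loE hiE; split.
apply: countable_bigcupT_measurable => // -[F G]; case: ifP => // _.
apply: measurableI.
  exact: (mE lo (fun j => [set k | 1 <= j /\ k <= 0])).
exact: (mE hi (fun j => [set k | j <= 0 /\ 1 <= k])).
Qed.

Definition equivalent_with_density d (T : measurableType d) (R : realType)
    (nu mu : set T -> \bar R) (f : T -> R) : Prop :=
  [/\ nu `<< mu, mu `<< nu &
      forall A, measurable A -> nu A = (\int[mu]_(x in A) (f x)%:E)%E].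

Section exchangeability.
Context {R : realType}.
Implicit Types (q : R) (mu : set permZ -> \bar R).

Definition right_q_exchangeable q mu := forall i : int,
  equivalent_with_density
    (pushforward mu (fun s : permZ => (s * transpZ i)%g)) mu
    (fun s : permZ => q ^ Num.sg (s (i + 1) - s i)).

Definition left_q_exchangeable q mu := forall i : int,
  equivalent_with_density
    (pushforward mu (fun s : permZ => (transpZ i * s)%g)) mu
    (fun s : permZ => q ^ Num.sg ((s^-1 : permZ)%g (i + 1) - (s^-1 : permZ)%g i)).

(* Measures on the balanced permutations are taken as measures on [permZ] that
   charge only the Borel set [balanced] (see [measurable_balanced]). *)
Definition is_mallows q (Q : probability permZ R) : Prop :=
  [/\ Q balanced = 1%E, right_q_exchangeable q Q & left_q_exchangeable q Q].

(* q-factorials: <n>_q is [qprod q n] and <oo>_q is [qprod_oo q]. *)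
Definition qprod q (n : nat) : R := \prod_(1 <= k < n.+1) (1 - q ^+ k).

Definition qprod_oo q : R := limn (qprod q).

End exchangeability.

(* Main.v *)
Require Import Defs.
From HB Require Import structures.
From mathcomp Require Import all_boot all_order all_algebra zify ring.
From mathcomp Require Import all_classical all_reals all_analysis.

Set Implicit Arguments.
Unset Strict Implicit.

Import Order.TTheory GRing.Theory Num.Theory.
Import numFieldNormedType.Exports.

Local Open Scope classical_set_scope.
Local Open Scope ring_scope.

(** Look at the graph of a permutation [s] near its point [(j, s j)], and let
[k] count the later positions with a smaller value and [m] the earlier
positions with a larger value.  For a balanced permutation [s j - j = k - m]
([balanced_cross]), so the law of the displacement follows from the law of the
pair [(k, m)].

Fix the point [(j, v)] and the pair, and let [e j v k m] be the probability of
this configuration ([pcross]).  Swapping the images of [j] and [j + 1] when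
[s j < s (j + 1)] moves the point one step to the right, puts one more larger
value on its left, and multiplies the probability by [q].  The swap is possible
exactly when the image of [j + 1] exceeds [v]; conversely one arrives at
permutations whose image of [j] exceeds [v].  Both conditions have a computable
conditional probability: read the values after position [j] as a word in the
two letters 'below [v]' and 'not below [v]', with [k] letters of the first
kind.  By exchangeability such words are weighted by [q] to the number of
inversions, so the first letter is 'not below' with probability [q ^+ k],
whatever happens elsewhere ([first_not_below]).  Hence ([pcross_right])
<<
  (1 - q^(m+1)) e (j+1) v k (m+1) = q^(k+1) e j v k m.
>>
The maps [s |-> (i |-> - s (- i))] and [s |-> s^-1] exchange the two counts and
carry a Mallows measure to a right exchangeable measure, so the same recurrence
holds with the point moved left or up instead of right.  Together the three
recurrences give [e j v k m = c q^(km+k+m) / (<k>_q <m>_q)] for [v = j + k - m],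
with [c] free of [j] ([pcross_qweight]).

The constant is found from total mass one.  With
[G k = sum_m q^((k+1)m) / <m>_q] the total is [c sum_k q^k G k / <k>_q].  The
recurrence [G (k+1) = (1 - q^(k+1)) G k] and [G k --> 1] give
[G k = <k>_q G 0] and [G 0 = 1 / <oo>_q], so the total is
[c / ((1 - q) <oo>_q)]. *)

Implicit Types (s t : permZ) (i j p v : int).

(** * Symmetries of the permutations of the integers *)

(** The topology is generated by the evaluations at the integers. *)
Lemma continuous_permZ (f : permZ -> permZ) :
  (forall i k, open [set s | f s i = k]) -> continuous f.
Proof.
move=> fo.
apply: (@continuous_comp_initial _ permZ
  {ptws int -> discrete_topology int} set_val f).
move=> s; apply/cvg_sup.
  have F0 : Filter (nbhs s) by exact: nbhs_filter.
  exact: (@fmap_filter _ _ _ _ F0).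
move=> i; move: s.
apply: (@continuous_comp_initial _ permZ (discrete_topology int)
  (fun g : int -> discrete_topology int => g i)).
apply/continuousP => A _.
rewrite (_ : _ @^-1` A = \bigcup_(k in A) [set s | f s i = k]).
  exact: bigcup_open.
apply/seteqP; split => [s As|s [k Ak fk]]; first by exists (f s i).
by rewrite -fk in Ak.
Qed.

Lemma open_eval (i k : int) : open [set s : permZ | s i = k].
Proof.
exists [set f : {ptws int -> discrete_topology int} | f i = k]; last by [].
apply: (@open_comp _ _ (fun f : {ptws int -> discrete_topology int} => f i)
  [set k : discrete_topology int]) => [f _|]; last exact: discrete_open.
exact: (@proj_continuous int (fun=> discrete_topology int) i).
Qed.

Lemma continuous_permZ_measurable (f : permZ -> permZ) :
  continuous f -> measurable_fun setT f.
Proof.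
move=> cf; apply: (@measurability _ _ permZ permZ setT f (@open permZ)) => //.
move=> _ [B oB <-]; rewrite setTI.
by apply: sub_sigma_algebra; move/continuousP: cf; apply.
Qed.

(** Rotation of the graph by a half turn. *)
Definition flipZ (s : permZ) : permZ :=
  mk_permZ (bij_comp (inv_bij (@opprK int))
    (bij_comp (permZ_bij s) (inv_bij (@opprK int)))).

(** The group inverse, under a name that can carry the instance of a measurable
function. *)
Definition invZ (s : permZ) : permZ := (s^-1)%g.

Local Notation rswap s i := (s * transpZ i : permZ)%g.
Local Notation lswap s i := (transpZ i * s : permZ)%g.

Lemma flipZE s i : flipZ s i = - s (- i). Proof. by []. Qed.

Lemma invZK s : cancel s (invZ s). Proof. exact: permZ_funK. Qed.
Lemma invZKV s : cancel (invZ s) s. Proof. exact: permZ_funKV. Qed.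

Lemma permZ_inj (s : permZ) : injective s.
Proof. exact: bij_inj (permZ_bij s). Qed.

Lemma invZ_eq s i k : (invZ s i = k) <-> (s k = i).
Proof. by split=> [<-|<-]; rewrite ?invZK ?invZKV. Qed.

Lemma flipZK : involutive flipZ.
Proof. by move=> s; apply: permZP => i; rewrite !flipZE !opprK. Qed.

Lemma invZ_invol : involutive invZ.
Proof. by move=> s; apply: permZP => i; apply/invZ_eq; rewrite invZK. Qed.

Lemma transpZ_l i : transpZ i i = i + 1.
Proof. by rewrite /permZ_fun /= /swap_succ eqxx. Qed.

Lemma transpZ_r i : transpZ i (i + 1) = i.
Proof.
rewrite /permZ_fun /= /swap_succ eqxx.
by have -> : (i + 1 == i) = false by lia.
Qed.

Lemma transpZ_id i k : k != i -> k != i + 1 -> transpZ i k = k.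
Proof. by rewrite /permZ_fun /= /swap_succ => /negPf -> /negPf ->. Qed.

Lemma rswapl s i : (rswap s i) i = s (i + 1).
Proof. by rewrite permZM transpZ_l. Qed.

Lemma rswapr s i : (rswap s i) (i + 1) = s i.
Proof. by rewrite permZM transpZ_r. Qed.

Lemma rswap_id s i k : k != i -> k != i + 1 -> (rswap s i) k = s k.
Proof. by move=> ? ?; rewrite permZM transpZ_id. Qed.

Lemma transpZK i : involutive (transpZ i). Proof. exact: swap_succK. Qed.

Lemma rswapK i : involutive (fun s => rswap s i).
Proof. by move=> s; apply: permZP => k; rewrite !permZM transpZK. Qed.

Lemma rswap_flipZ s i : flipZ (rswap s i) = rswap (flipZ s) (- i - 1).
Proof.
apply: permZP => k; rewrite flipZE !permZM flipZE; congr (- s _).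
have [->|ki] := eqVneq k (- i - 1).
  have -> : - (- i - 1) = i + 1 by lia.
  by rewrite transpZ_l transpZ_r; lia.
have [->|ki'] := eqVneq k (- i - 1 + 1).
  have -> : - (- i - 1 + 1) = i by lia.
  by rewrite transpZ_l transpZ_r; lia.
by rewrite !transpZ_id //; lia.
Qed.

Lemma invZ_lswap s i : invZ (lswap s i) = rswap (invZ s) i.
Proof. by apply: permZP => k; apply/invZ_eq; rewrite !permZM invZKV transpZK. Qed.

Lemma flipZ_measurable : measurable_fun setT flipZ.
Proof.
apply: continuous_permZ_measurable; apply: continuous_permZ => i k.
rewrite (_ : mkset _ = [set s : permZ | s (- i) = - k]); first exact: open_eval.
by apply/seteqP; split => s /=; rewrite flipZE; lia.
Qed.

Lemma invZ_measurable : measurable_fun setT invZ.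
Proof.
apply: continuous_permZ_measurable; apply: continuous_permZ => i k.
rewrite (_ : mkset _ = [set s : permZ | s k = i]); first exact: open_eval.
by apply/seteqP; split => s /= /invZ_eq.
Qed.

HB.instance Definition _ :=
  isMeasurableFun.Build _ _ permZ permZ flipZ flipZ_measurable.
HB.instance Definition _ :=
  isMeasurableFun.Build _ _ permZ permZ invZ invZ_measurable.

(** * Exchangeability as a rule for swapping ascents *)

(** The consequence of right exchangeability that the proof uses, free of
densities: turning an ascent into a descent costs a factor [q].  In this form
it passes easily to image measures. *)
Definition right_swap {R : realType} (q : R) (mu : set permZ -> \bar R) :=
  forall (i : int) (A : set permZ), measurable A ->
    A `<=` [set s | s i < s (i + 1)] ->
  mu [set s | A (rswap s i)] = (q%:E * mu A)%E.

Lemma right_swap_exch {R : realType} (q : R) (Q : probability permZ R) :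
  right_q_exchangeable q Q -> right_swap q Q.
Proof.
move=> Qx i A mA Ai; have [_ _ /(_ A mA)] := Qx i.
rewrite /pushforward /preimage /= => ->.
rewrite -integral_cst//; apply: eq_integral => s /set_mem/Ai /= ss.
by rewrite gtr0_sg ?subr_gt0 // expr1z.
Qed.

Lemma right_swap_flipZ {R : realType} (q : R) (Q : probability permZ R) :
  right_swap q Q -> right_swap q (distribution Q flipZ).
Proof.
move=> Qx i A mA Ai; rewrite /distribution /pushforward /preimage /=.
rewrite -(Qx (- i - 1)).
- by congr (Q _); apply/seteqP; split => s /=; rewrite rswap_flipZ;
     rewrite (_ : - (- i - 1) - 1 = i) //; lia.
- by rewrite -[mkset _]setTI; exact: flipZ_measurable.
- move=> s /Ai /=; rewrite !flipZE ltrN2.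
  by rewrite opprD subrK.
Qed.

(** Inversion turns left multiplication by a transposition into right
multiplication, so this is where left exchangeability enters. *)
Lemma right_swap_invZ {R : realType} (q : R) (Q : probability permZ R) :
  left_q_exchangeable q Q -> right_swap q (distribution Q invZ).
Proof.
move=> Qx i A mA Ai; rewrite /distribution /pushforward /preimage /=.
have mB : measurable [set s | A (invZ s)].
  by rewrite -[mkset _]setTI; exact: invZ_measurable.
have [_ _ /(_ _ mB)] := Qx i.
rewrite /pushforward /preimage /= => QE.
rewrite -integral_cst// (_ : mkset _ = [set s | A (invZ (lswap s i))]);
    last first.
  by apply/seteqP; split => s /=; rewrite invZ_lswap.
rewrite QE; apply: eq_integral => s /set_mem/Ai /= ss.
by rewrite gtr0_sg ?subr_gt0 // expr1z.
Qed.

(** * Counting crossings *)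

(** The lower right and the upper left quadrant at [(p, v)] in the graph of [s],
seen through their positions. *)
Definition below s p v : set int := [set i | p < i /\ s i < v].
Definition above s p v : set int := [set i | i < p /\ v < s i].

Lemma card_preimage_bij {T U : Type} (f : T -> U) (B : set U) :
  bijective f -> (f @^-1` B #= B)%card.
Proof.
move=> [g fK gK]; rewrite card_eq_sym.
rewrite (_ : f @^-1` B = g @` B).
  by rewrite card_eq_sym; apply: inj_card_eq => x y _ _; exact: (can_inj gK).
apply/seteqP; split => [x Bx|_ [y By <-]] /=; first by exists (f x).
by rewrite gK.
Qed.

Lemma card_D1 {T : Type} (A : set T) x n :
  A x -> (A #= `I_n.+1)%card = (A `\ x #= `I_n)%card.
Proof.
move=> Ax; apply/idP/idP => [An|An]; last by apply/eq_cardSP; exists x.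
have /finite_setP[m Am] : finite_set (A `\ x).
  by apply: finite_setD; apply/finite_setP; exists n.+1.
have /eq_cardSP Am1 : exists2 y, A y & (A `\ y #= `I_m)%card by exists x.
suff -> : n = m by [].
by apply/succn_inj/card_eq_II; rewrite -(card_eql An).
Qed.

(** The half turn exchanges the two quadrants, and so does the reflection of the
graph in the diagonal, which also exchanges position and value. *)
Lemma above_flipZ s p v m :
  (above (flipZ s) p v #= `I_m)%card = (below s (- p) (- v) #= `I_m)%card.
Proof.
rewrite -(card_eql (card_preimage_bij (below s (- p) (- v))
  (inv_bij (@opprK int)))).
congr (_ #= _)%card; apply/seteqP; split => i /=; rewrite /above/below/= flipZE;
  move: (s (- i)) => x; lia.
Qed.

Lemma below_flipZ s p v m :
  (below (flipZ s) p v #= `I_m)%card = (above s (- p) (- v) #= `I_m)%card.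
Proof. by rewrite -[s in RHS]flipZK above_flipZ !opprK. Qed.

Lemma above_invZ s p v m :
  (above (invZ s) p v #= `I_m)%card = (below s v p #= `I_m)%card.
Proof.
rewrite -(card_eql (card_preimage_bij (above (invZ s) p v) (permZ_bij s))).
congr (_ #= _)%card; apply/seteqP; split => i; rewrite /above/below/= invZK; lia.
Qed.

Lemma below_invZ s p v m :
  (below (invZ s) p v #= `I_m)%card = (above s v p #= `I_m)%card.
Proof. by rewrite -[s in RHS]invZ_invol above_invZ. Qed.

Definition none_below n p v : set permZ :=
  [set s | forall i, p < i <= p + n%:Z -> v <= s i].

Lemma below0 s p v : (below s p v #= `I_0)%card <-> forall i, p < i -> v <= s i.
Proof.
rewrite II0 card_eq0; split => [/eqP b0 i pi|sv].
  rewrite leNgt; apply/negP => siv.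
  by have : below s p v i by []; rewrite b0.
by apply/eqP/seteqP; split => // i [/sv]; lia.
Qed.

Lemma belowD1 s p v n k : none_below n p v s -> s (p + n.+1%:Z) < v ->
  (below s p v #= `I_k.+1)%card = (below s (p + n.+1%:Z) v #= `I_k)%card.
Proof.
move=> sn snv; rewrite (@card_D1 _ _ (p + n.+1%:Z)); last by split => //; lia.
congr (_ #= _)%card; apply/seteqP; split => i; rewrite /below/=.
  move=> [[pi siv] /eqP ni]; split => //.
  by have := sn i; lia.
by move=> [pi siv]; split; [lia|apply/eqP; lia].
Qed.

(** Cutting at the first entry below [v], the one at position [p + n + 1].  All
arguments by recursion on the count, and its measurability, rest on this. *)
Lemma below_recE s p v k : (below s p v #= `I_k.+1)%card <->
  exists n, [/\ none_below n p v s, s (p + n.+1%:Z) < v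
              & (below s (p + n.+1%:Z) v #= `I_k)%card].
Proof.
split=> [bk|[n [sn snv bn]]]; last by rewrite (belowD1 k sn).
have [i [pi siv] _] := elimT (eq_cardSP _ _) bk.
have ex : exists n : nat, s (p + n.+1%:Z) < v.
  by exists (absz (i - p)).-1; rewrite (_ : p + _ = i) //; lia.
case: (ex_minnP ex) => n snv nmin; exists n.
have sn : none_below n p v s.
  move=> l pl; rewrite leNgt; apply/negP => slv.
  have := nmin (absz (l - p)).-1; rewrite (_ : p + _ = l); last by lia.
  by move=> /(_ slv); lia.
by split => //; rewrite -(belowD1 k sn).
Qed.

Lemma below_shift s p v k : v <= s (p + 1) ->
  (below s p v #= `I_k)%card = (below s (p + 1) v #= `I_k)%card.
Proof.
move=> sp; congr (_ #= _)%card; apply/seteqP; split=> i; rewrite /below/=; last by lia.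
by have [->|] := eqVneq i (p + 1); lia.
Qed.

Lemma above_step s p v k : v < s p ->
  (above s (p + 1) v #= `I_k.+1)%card = (above s p v #= `I_k)%card.
Proof.
move=> vs; rewrite (@card_D1 _ _ p); last by split => //; lia.
congr (_ #= _)%card; apply/seteqP; split => i; rewrite /above/=.
  by move=> [[ip vi] /eqP ni]; split => //; lia.
by move=> [ip vi]; split; [lia|apply/eqP; lia].
Qed.

Lemma above_shift s p v k : s p <= v ->
  (above s (p + 1) v #= `I_k)%card = (above s p v #= `I_k)%card.
Proof.
move=> sp; congr (_ #= _)%card; apply/seteqP; split=> i; rewrite /above/=; last by lia.
by have [->|] := eqVneq i p; lia.
Qed.

Lemma eq_below s t p v :
  (forall i, p < i -> s i = t i) -> below s p v = below t p v.
Proof.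
by move=> st; apply/seteqP; split=> i [pi]; rewrite /below/= ?st // -?st // => ?.
Qed.

Lemma eq_above s t p v :
  (forall i, i < p -> s i = t i) -> above s p v = above t p v.
Proof.
by move=> st; apply/seteqP; split=> i [pi]; rewrite /above/= ?st // -?st // => ?.
Qed.

Lemma measurable_none_below n p v : measurable (none_below n p v).
Proof.
exact: (measurable_evals (fun i => [set x | p < i <= p + n%:Z -> v <= x])).
Qed.

Lemma measurable_below p v k : measurable [set s | (below s p v #= `I_k)%card].
Proof.
elim: k p => [p|k IH p].
  rewrite (_ : mkset _ =
      [set s : permZ | forall i, [set x | p < i -> v <= x] (s i)]).
    exact: (measurable_evals (fun i => [set x | p < i -> v <= x])).
  by apply/seteqP; split => s /= /below0.
rewrite (_ : mkset _ = \bigcup_n (none_below n p v `&`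
    [set s | s (p + n.+1%:Z) < v] `&`
    [set s | (below s (p + n.+1%:Z) v #= `I_k)%card])).
  apply: bigcupT_measurable => n; apply: measurableI; last exact: IH.
  apply: measurableI; first exact: measurable_none_below.
  exact: (measurable_evalP _ [set x | x < v]).
apply/seteqP; split => s /=.
  by move=> /below_recE[n [? ? ?]]; exists n.
by move=> [n _ [[? ?] ?]]; apply/below_recE; exists n.
Qed.

Lemma measurable_above p v k : measurable [set s | (above s p v #= `I_k)%card].
Proof.
rewrite (_ : mkset _ = [set s | (below (invZ s) v p #= `I_k)%card]); last first.
  by apply/seteqP; split => s /=; rewrite below_invZ.
rewrite -[mkset _]setTI; apply: (@invZ_measurable _ _ (measurable_below v p k)).
exact: measurableT.
Qed.

(** * The first letter of a word of fixed content *)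

Section words.
Context {R : realType} (q : R).

(** A word with exactly [k] letters below [v] starts with a letter not below [v]
with conditional probability [q ^+ k], given any event [H] that rearrangements
after [p] preserve.  By induction on [k]: let [B n] be the event that the first
letter below [v] is the [n.+1]-st.  By induction the next letter is not below
[v] with probability [q ^+ k], and then swapping the two leads to [B n.+1] at
the cost of a factor [q]; so [Q (B n)] is geometric with ratio [q ^+ k.+1].
The word starts with a letter not below [v] outside [B 0], and removing its
first term multiplies the sum of a geometric series by the ratio. *)
Lemma first_not_below (Q : probability permZ R) (H : set permZ) p v k :
  right_swap q Q -> measurable H ->
  (forall i s, p < i -> H s -> H (rswap s i)) ->
  Q (H `&` [set s | (below s p v #= `I_k)%card] `&` [set s | v <= s (p + 1)]) =
  ((q ^+ k)%:E * Q (H `&` [set s | (below s p v #= `I_k)%card]))%E.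
Proof.
move=> Qx; elim: k p H => [|k IH] p H mH Hinv.
  rewrite expr0 mul1e; congr (Q _); apply/seteqP; split=> [s [[]//]|s [Hs /= b0]].
  by split => //=; apply: (proj1 (below0 _ _ _) b0); lia.
pose H' n := H `&` none_below n p v `&` [set s | s (p + n.+1%:Z) < v].
pose B n := H' n `&` [set s | (below s (p + n.+1%:Z) v #= `I_k)%card].
have mH' n : measurable (H' n).
  apply: measurableI; first by apply: measurableI => //; exact: measurable_none_below.
  exact: (measurable_evalP _ [set x | x < v]).
have mB n : measurable (B n) by apply: measurableI => //; exact: measurable_below.
have tB : trivIset setT B.
  apply/trivIsetP => m n _ _; wlog mn : m n / (m < n)%N => [hw|_].
    rewrite neq_ltn => /orP[mn|nm]; first by apply: hw => //; lia.
    by rewrite setIC; apply: hw => //; lia.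
  apply/seteqP; split => // s [[[_ /= smv] _] [[[_ snb] _] _]].
  by have := snb (p + m.+1%:Z); lia.
have BE : H `&` [set s | (below s p v #= `I_k.+1)%card] = \bigcup_n B n.
  apply/seteqP; split => s.
    by move=> [Hs /below_recE[n [? ? ?]]]; exists n.
  by move=> [n _ [[[Hs ?] ?] ?]]; split => //; apply/below_recE; exists n.
have BSE : H `&` [set s | (below s p v #= `I_k.+1)%card]
    `&` [set s | v <= s (p + 1)] = \bigcup_n B n.+1.
  rewrite BE; apply/seteqP; split => s.
    move=> [[[|n] _ Bn] /= vs]; last by exists n.
    by case: Bn => -[_ sv] _; have : s (p + 1) < v := sv; lia.
  move=> [n _ Bn]; split; first by exists n.+1.
  by move: Bn => [[[_ /(_ (p + 1))]]] + _ _ /=; apply; lia.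
(* the swap at the first letter below v identifies part of B n with B n.+1 *)
have QB n : Q (B n.+1) = ((q ^+ k.+1)%:E * Q (B n))%E.
  pose p' := p + n.+1%:Z.
  have p'S : p' + 1 = p + n.+2%:Z by rewrite /p'; lia.
  have H'inv i s : p' < i -> H' n s -> H' n (rswap s i).
    move=> pi [[Hs snb] snv]; split; first split.
    - by apply: Hinv => //; rewrite /p' in pi; lia.
    - move=> l pl; rewrite rswap_id; [exact: snb| |]; rewrite /p' in pi; lia.
    - by rewrite /= rswap_id //; rewrite /p' in pi; lia.
  rewrite exprS EFinM -muleA -(IH p' (H' n) (mH' n) H'inv) -(Qx p'); last 2 first.
  - apply: measurableI; first exact: mB.
    exact: (measurable_evalP _ [set x | v <= x]).
  - by move=> s [[[_ /=]]]; rewrite /p'; lia.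
  congr (Q _); apply/seteqP; split => s.
    move=> [[[Hs snb] /= snv] sb]; split; last first.
      by rewrite /= rswapr; apply: snb; rewrite /p'; lia.
    split; first split; first split.
    - by apply: Hinv => //; rewrite /p'; lia.
    - move=> l pl; rewrite rswap_id; [apply: snb| |]; rewrite /p'; lia.
    - by rewrite -/p' /= rswapl p'S.
    - rewrite -/p' /= below_shift; last first.
        by rewrite rswapr; apply: snb; rewrite /p'; lia.
      rewrite p'S -(@eq_below s) // => i pi.
      by rewrite rswap_id // /p'; lia.
  move=> [[[[Hs snb] /= snv] sb] vs].
  rewrite -/p' rswapl in snv; rewrite rswapr in vs.
  split; first split; first split.
  - by rewrite -(rswapK p' s); apply: Hinv => //; rewrite /p'; lia.
  - move=> l pl; have [->//|lp] := eqVneq l p'.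
    have := snb l; rewrite rswap_id; [apply; rewrite /p' in lp| |];
      by rewrite /p' in lp *; lia.
  - by rewrite /= -p'S.
  - move: sb; rewrite /= -/p' below_shift; last by rewrite rswapr.
    rewrite p'S -(@eq_below s) // => i pi.
    by rewrite rswap_id // /p'; lia.
rewrite BSE BE !measure_bigcup //=.
rewrite (eq_eseriesr (fun n _ => QB n)) nneseriesZl //.
by apply/trivIsetP => m n _ _ mn; move/trivIsetP: tB; apply=> //; lia.
Qed.

Lemma first_not_above (Q : probability permZ R) (H : set permZ) p v k :
  right_swap q Q -> measurable H ->
  (forall i s, i + 1 < p -> H s -> H (rswap s i)) ->
  Q (H `&` [set s | (above s p v #= `I_k)%card] `&` [set s | s (p - 1) <= v]) =
  ((q ^+ k)%:E * Q (H `&` [set s | (above s p v #= `I_k)%card]))%E.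
Proof.
move=> Qx mH Hinv.
have := @first_not_below (distribution Q flipZ) (flipZ @^-1` H) (- p) (- v) k.
have dE A :
  (distribution Q flipZ : probability permZ R) A = Q (flipZ @^-1` A) by [].
rewrite !dE !preimage_setI.
rewrite (_ : flipZ @^-1` (flipZ @^-1` H) = H); last first.
  by apply/seteqP; split => s /=; rewrite flipZK.
rewrite (_ : flipZ @^-1` [set s | (below _ _ _ #= _)%card] =
    [set s | (above s p v #= `I_k)%card]); last first.
  by apply/seteqP; split => s /=; rewrite below_flipZ !opprK.
rewrite (_ : flipZ @^-1` [set s | - v <= _] =
    [set s | s (p - 1) <= v]); last first.
  by apply/seteqP; split => s /=; rewrite flipZE lerN2 opprD opprK.
apply.
- exact: right_swap_flipZ.
- by rewrite -[X in measurable X]setTI; exact: flipZ_measurable.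
- by move=> i s pi /= Hs; rewrite rswap_flipZ; apply: Hinv => //; lia.
Qed.

End words.

(** * The weights of the crossing counts *)

Section weights.
Context {R : realType} (q : R).
Hypotheses (q0 : 0 < q) (q1 : q < 1).

Lemma onem_expr_neq0 n : 1 - q ^+ n.+1 != 0.
Proof. by rewrite subr_eq0 eq_sym lt_eqF // exprn_ilt1 // ltW. Qed.

Lemma qprodS n : qprod q n.+1 = qprod q n * (1 - q ^+ n.+1).
Proof. by rewrite /qprod big_nat_recr. Qed.

Lemma qprod_gt0 n : 0 < qprod q n.
Proof.
elim: n => [|n IH]; first by rewrite /qprod big_geq.
by rewrite qprodS mulr_gt0 // subr_gt0 exprn_ilt1 // ltW.
Qed.

Definition qweight k m : R := q ^+ (k * m + k + m) / (qprod q k * qprod q m).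

Lemma qweight_ge0 k m : 0 <= qweight k m.
Proof. by rewrite divr_ge0 ?exprn_ge0 ?ltW // mulr_gt0 ?qprod_gt0. Qed.

Lemma qweight0 : qweight 0 0 = 1.
Proof. by rewrite /qweight /qprod big_geq // mulr1 invr1 mulr1. Qed.

Lemma qweightSl k m : (1 - q ^+ k.+1) * qweight k.+1 m = q ^+ m.+1 * qweight k m.
Proof.
rewrite /qweight qprodS (_ : _ + m = m.+1 + (k * m + k + m))%N; last by lia.
rewrite exprD.
by field; rewrite onem_expr_neq0 !lt0r_neq0 ?qprod_gt0.
Qed.

Lemma qweightC k m : qweight k m = qweight m k.
Proof. by rewrite /qweight mulnC addnAC [qprod q k * _]mulrC. Qed.

End weights.

(** * Recurrences for the law of the crossing counts *)

Definition cross j v (k m : nat) : set permZ :=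
  [set s : permZ | [/\ s j = v, (below s j v #= `I_k)%card
                      & (above s j v #= `I_m)%card]].

Lemma crossE j v k m : cross j v k m =
  [set s : permZ | s j = v] `&` [set s | (above s j v #= `I_m)%card]
    `&` [set s | (below s j v #= `I_k)%card].
Proof. by apply/seteqP; split => [s [? ? ?]|s [[]]]. Qed.

Lemma measurable_cross j v k m : measurable (cross j v k m).
Proof.
rewrite crossE; apply: measurableI; last exact: measurable_below.
by apply: measurableI; [exact: measurable_eval | exact: measurable_above].
Qed.

Section recurrence.
Context {R : realType} (q : R).
Implicit Types Q : probability permZ R.

Definition pcross Q j v k m : R := fine (Q (cross j v k m)).

Lemma pcrossE Q j v k m : Q (cross j v k m) = (pcross Q j v k m)%:E.
Proof. by rewrite fineK // fin_num_measure //; exact: measurable_cross. Qed.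

Lemma pcross_flipZ Q j v k m :
  pcross (distribution Q flipZ) j v k m = pcross Q (- j) (- v) m k.
Proof.
congr (fine (Q _)); apply/seteqP; split=> s; rewrite /cross /=.
  rewrite flipZE below_flipZ above_flipZ.
  by move=> [sj ? ?]; split => //; rewrite -sj opprK.
rewrite flipZE below_flipZ above_flipZ.
by move=> [sj ? ?]; split => //; rewrite sj opprK.
Qed.

Lemma pcross_invZ Q j v k m :
  pcross (distribution Q invZ) j v k m = pcross Q v j m k.
Proof.
congr (fine (Q _)); apply/seteqP; split=> s; rewrite /cross /= below_invZ above_invZ.
  by move=> [/invZ_eq ? ? ?].
by move=> [? ? ?]; split => //; apply/invZ_eq.
Qed.

(** Both sides are the probability of the permutations in
[cross (j + 1) v k m.+1] whose image of [j] exceeds [v].  On the left this is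
the complement of the event in [first_not_above].  On the right these are the
swaps at [j] of the permutations in [cross j v k m] whose image of [j + 1] is
not below [v], an event of conditional probability [q ^+ k]; the swap accounts
for one more factor [q]. *)
Lemma pcross_right Q j v k m : right_swap q Q ->
  (1 - q ^+ m.+1) * pcross Q (j + 1) v k m.+1 = q ^+ k.+1 * pcross Q j v k m.
Proof.
move=> Qx; pose C := cross (j + 1) v k m.+1.
pose L := [set s : permZ | s j <= v].
have mL : measurable L by exact: (measurable_evalP _ [set x | x <= v]).
have mC : measurable C by exact: measurable_cross.
have QCL : Q (C `&` L) = ((q ^+ m.+1)%:E * Q C)%E.
  have := @first_not_above _ q Q ([set s : permZ | s (j + 1) = v] `&`
    [set s | (below s (j + 1) v #= `I_k)%card]) (j + 1) v m.+1 Qx.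
  rewrite addrK -/L (setIAC [set s : permZ | s (j + 1) = v]) -crossE; apply.
    by apply: measurableI; [exact: measurable_eval | exact: measurable_below].
  move=> i s ij [/= sj sb]; split => /=; first by rewrite rswap_id //; lia.
  by rewrite (@eq_below _ s) // => l jl; rewrite rswap_id //; lia.
have QCL' : Q (C `\` L) = ((q ^+ k.+1)%:E * Q (cross j v k m))%E.
  pose A := cross j v k m `&` [set s | v <= s (j + 1)].
  have -> : C `\` L = [set s | A (rswap s j)].
    apply/seteqP; split => s; rewrite /C /A /cross /L /=.
      move=> [[sj sb sa] /negP]; rewrite -ltNge => vs.
      rewrite rswapl rswapr; split; last by lia.
      split => //.
        rewrite below_shift ?rswapr; last by lia.
        by rewrite (@eq_below _ s) // => l jl; rewrite rswap_id //; lia.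
      move: sa; rewrite above_step // (@eq_above _ s) // => l jl.
      by rewrite rswap_id //; lia.
    rewrite rswapl rswapr => -[[sj sb sa] vs].
    have {}vs : v < s j.
      by rewrite lt_neqAle vs andbT -sj; apply/eqP => /permZ_inj; lia.
    split; last by apply/negP; rewrite -ltNge.
    split => //.
      move: sb; rewrite below_shift ?rswapr; last by lia.
      by rewrite (@eq_below _ s) // => l jl; rewrite rswap_id //; lia.
    rewrite above_step //; move: sa; rewrite (@eq_above _ s) // => l jl.
    by rewrite rswap_id //; lia.
  rewrite Qx.
  - rewrite exprS EFinM -muleA; congr (_ * _)%E.
    rewrite /A crossE; apply: (@first_not_below _ q Q) => //.
      by apply: measurableI; [exact: measurable_eval | exact: measurable_above].
    move=> i s ij [/= sj sa]; split => /=; first by rewrite rswap_id //; lia.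
    by rewrite (@eq_above _ s) // => l jl; rewrite rswap_id //; lia.
  - apply: measurableI; first exact: measurable_cross.
    exact: (measurable_evalP _ [set x | v <= x]).
  - move=> s [[<- _ _]] /=; rewrite le_eqVlt => /orP[/eqP/permZ_inj|//]; lia.
have : Q C = (Q (C `\` L) + Q (C `&` L))%E by exact: measureDI.
rewrite QCL QCL' /C !pcrossE -!EFinM -EFinD => -[] H.
by rewrite mulrBl mul1r {1}H addrK.
Qed.

Section solve.
Variable Q : probability permZ R.
Hypotheses (Qr : right_q_exchangeable q Q) (Ql : left_q_exchangeable q Q).
Hypotheses (q0 : 0 < q) (q1 : q < 1).

Let Qx : right_swap q Q := right_swap_exch Qr.
Let e := pcross Q.

Let pcross_up j v k m :
  (1 - q ^+ k.+1) * e j (v + 1) k.+1 m = q ^+ m.+1 * e j v k m.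
Proof.
have := pcross_right v j m k (right_swap_invZ Ql).
by rewrite !pcross_invZ.
Qed.

Let pcross_left j v k m :
  (1 - q ^+ k.+1) * e (j - 1) v k.+1 m = q ^+ m.+1 * e j v k m.
Proof.
have := pcross_right (- j) (- v) m k (right_swap_flipZ Qx).
by rewrite !pcross_flipZ opprD !opprK.
Qed.

(* The point (i, i + 1) with one later smaller value is reached from (i, i) by
   moving up and from (i + 1, i + 1) by moving left, at the same cost. *)
Let pcross00 j : e j j 0 0 = e 0 0 0 0.
Proof.
suff step i : e (i + 1) (i + 1) 0%N 0%N = e i i 0%N 0%N.
  elim/int_rec: j => [//|n <-|n <-].
    by rewrite -(step n) (_ : n%:Z + 1 = n.+1%:Z) //; lia.
  by rewrite -(step (- n.+1%:Z)) (_ : - n.+1%:Z + 1 = - n%:Z) //; lia.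
apply: (mulfI (lt0r_neq0 q0)).
have := pcross_up i i 0 0; rewrite !expr1 => <-.
by have := pcross_left (i + 1) (i + 1) 0 0; rewrite !expr1 addrK => <-.
Qed.

Lemma pcross_qweight j k m :
  pcross Q j (j + k%:Z - m%:Z) k m = pcross Q 0 0 0 0 * qweight q k m.
Proof.
elim: m j => [|m IHm] j.
  rewrite subr0; elim: k j => [|k IHk] j.
    by rewrite addr0 qweight0 mulr1 -/e pcross00.
  apply: (mulfI (onem_expr_neq0 q0 q1 k)).
  rewrite mulrCA (qweightSl q0 q1) mulrCA -(IHk j).
  rewrite (_ : j + k.+1%:Z = j + k%:Z + 1); last by lia.
  exact: pcross_up.
apply: (mulfI (onem_expr_neq0 q0 q1 m)).
rewrite mulrCA [qweight _ _ _]qweightC (qweightSl q0 q1) mulrCA qweightC -(IHm (j - 1)).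
have := pcross_right (j - 1) (j + k%:Z - m.+1%:Z) k m Qx.
by rewrite subrK => ->; rewrite (_ : j - 1 + _ - _ = j + k%:Z - m.+1%:Z) //; lia.
Qed.

End solve.
End recurrence.

(** * Balance and displacement *)

(** Balance at an arbitrary cut between positions [p] and [p + 1] and between
values [u] and [u + 1]: the difference of the two crossing counts must make up
for the distance of the cut from the diagonal.  The cut at [(0, 0)] is the
balance condition; the property is independent of the cut. *)
Definition cut_balanced s p u := exists a b : nat,
  [/\ (below s p (u + 1) #= `I_a)%card, (above s (p + 1) u #= `I_b)%card
    & a%:Z + p = b%:Z + u].

Lemma below_step s p v k : s (p + 1) < v ->
  (below s p v #= `I_k.+1)%card = (below s (p + 1) v #= `I_k)%card.
Proof. by move=> sv; apply: (@belowD1 _ _ _ 0) => // i; lia. Qed.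

Lemma cut_balanced_step s p u : cut_balanced s p u <-> cut_balanced s (p + 1) u.
Proof.
have [su|us] := leP (s (p + 1)) u.
  split=> -[a [b [Ha Hb ab]]].
    case: a Ha ab => [/below0/(_ (p + 1))|a Ha ab]; first by lia.
    exists a, b; split; last by lia.
      by rewrite -below_step //; lia.
    by rewrite above_shift.
  exists a.+1, b; split; last by lia.
    by rewrite below_step //; lia.
  by rewrite -above_shift.
split=> -[a [b [Ha Hb ab]]].
  exists a, b.+1; split; last by lia.
    by rewrite -below_shift //; lia.
  by rewrite above_step.
case: b Hb ab => [|b Hb ab].
  rewrite II0 card_eq0 => /eqP b0.
  by have : above s (p + 1 + 1) u (p + 1); [split => //; lia | rewrite b0].
exists a, b; split; last by lia.
  by rewrite below_shift //; lia.
by rewrite -above_step.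
Qed.

Lemma cut_balanced_row s p u : cut_balanced s 0 u -> cut_balanced s p u.
Proof.
move=> s0; elim/int_rec: p => [|n|n] //.
  by rewrite cut_balanced_step (_ : n%:Z + 1 = n.+1%:Z) //; lia.
by rewrite (cut_balanced_step _ (- n.+1%:Z)) (_ : - n.+1%:Z + 1 = - n%:Z) //; lia.
Qed.

Lemma cut_balanced_invZ s p u : cut_balanced (invZ s) u p -> cut_balanced s p u.
Proof.
move=> [a [b [Ha Hb ab]]]; exists b, a.
by split; [rewrite -above_invZ | rewrite -below_invZ | ].
Qed.

(** Move the cut to the position [j], then, in the inverse, to the value
[s j]. *)
Lemma balanced_cross s j : balanced s -> exists k m : nat,
  cross j (j + k%:Z - m%:Z) k m s.
Proof.
move=> [/finite_setP[a Ha] _ eqab].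
have : cut_balanced s 0 0.
  exists a, a; split => //.
  have -> : above s (0 + 1) 0 = [set j : int | j <= 0 /\ 1 <= s j].
    by apply/seteqP; split => i; rewrite /above /=; lia.
  by rewrite -(card_eql eqab).
move=> /(cut_balanced_row j); rewrite -{1}[s]invZ_invol => /cut_balanced_invZ.
move=> /(cut_balanced_row (s j)) /cut_balanced_invZ [k [m [Hk Hm km]]].
exists k, m; split; first by lia.
  rewrite (_ : _ + _ - _ = s j); last by lia.
  rewrite (_ : below s j (s j) = below s j (s j + 1)) //.
  apply/seteqP; split => i; rewrite /below /=; first by lia.
  move=> [ji sij]; split => //; rewrite lt_neqAle; apply/andP; split; last by lia.
  by apply/eqP => /permZ_inj; lia.
rewrite (_ : _ + _ - _ = s j); last by lia.
rewrite (_ : above s j (s j) = above s (j + 1) (s j)) //.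
apply/seteqP; split => i; rewrite /above /=; first by lia.
move=> [ji sij]; split => //.
by have [ij|] := eqVneq i j; [move: sij; rewrite ij ltxx | lia].
Qed.

(** * Sums over pairs of natural numbers *)

Lemma esum_nat2 (R : realType) (D : set (nat * nat)) (f : nat * nat -> \bar R) :
  (forall x, 0 <= f x)%E ->
  (\esum_(x in D) f x =
   \sum_(0 <= k <oo) \sum_(0 <= m <oo | (k, m) \in D) f (k, m))%E.
Proof.
move=> f0; rewrite nneseries_esumT; last by move=> k; exact: nneseries_ge0.
rewrite [in LHS](_ : D = setT `*`` (fun k => [set m | (k, m) \in D])); last first.
  apply/seteqP; split => -[k m] /=; last by move=> [_ /set_mem].
  by move=> Dkm; split => //; exact/mem_set.
transitivity (\esum_(k in [set: nat])
    \esum_(m in [set m | (k, m) \in D]) f (k, m))%E.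
  rewrite (@esum_esum R nat nat setT (fun k => [set m | (k, m) \in D])
    (fun k m => f (k, m))) //.
  by apply: eq_esum => -[].
by apply: eq_esum => k _; rewrite nneseries_esum.
Qed.

Lemma measure_bigcup_nat2 d (T : measurableType d) (R : realType)
    (mu : {measure set T -> \bar R}) (D : set (nat * nat))
    (F : nat * nat -> set T) :
  (forall x, measurable (F x)) -> trivIset D F ->
  (mu (\bigcup_(x in D) F x) = \esum_(x in D) mu (F x))%E.
Proof.
move=> mF tF; rewrite esum_nat2; last by move=> x; exact: measure_ge0.
pose G k := \bigcup_(m in [set m | (k, m) \in D]) F (k, m).
have mG k : measurable (G k) by apply: bigcup_measurable.
have -> : \bigcup_(x in D) F x = \bigcup_k G k.
  apply/seteqP; split => [t [[k m] Dkm Ft]|t [k _ [m /set_mem Dkm Ft]]].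
    by exists k => //; exists m => //; exact/mem_set.
  by exists (k, m).
rewrite measure_bigcup //; last first.
  move=> k k' _ _ [t [[m /set_mem Dm Ft] [m' /set_mem Dm' Ft']]].
  by have [] : (k, m) = (k', m') by apply: tF => //; exists t.
rewrite (@eq_eseriesl _ _ xpredT); last by move=> k; rewrite in_setT.
apply: eq_eseriesr => k _; rewrite measure_bigcup //; last first.
  move=> m m' /set_mem Dm /set_mem Dm' [t [Ft Ft']].
  by have [] : (k, m) = (k, m') by apply: tF => //; exists t.
apply: eq_eseriesl => m; apply/idP/idP => [/set_mem //|Dkm].
exact/mem_set.
Qed.

Lemma esumZl_nat2 (R : realType) (D : set (nat * nat)) (c : R)
    (f : nat * nat -> \bar R) :
  0 <= c -> (forall x, 0 <= f x)%E ->
  (\esum_(x in D) (c%:E * f x) = c%:E * \esum_(x in D) f x)%E.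
Proof.
move=> c0 f0; rewrite !esum_nat2 //; last by move=> x; exact: mule_ge0.
rewrite -nneseriesZl; last by move=> k _; exact: nneseries_ge0.
by apply: eq_eseriesr => k _; rewrite nneseriesZl.
Qed.

(** * The normalizing constant *)

Section q_series.
Context {R : realType} (q : R).
Hypotheses (q0 : 0 < q) (q1 : q < 1).

Local Notation qp := (qprod q).

(** Euler's series [sum_m t^m / <m>_q] at [t = q^(k+1)], called [G k] above.  It
is taken in the extended reals because the argument gets its finiteness from
total mass one. *)
Definition qexp k : \bar R := (\sum_(0 <= m <oo) (q ^+ (k.+1 * m) / qp m)%:E)%E.

Let term_ge0 k m : (0 <= (q ^+ (k.+1 * m) / qp m)%:E)%E.
Proof. by rewrite lee_fin divr_ge0 // ?exprn_ge0 // ltW // qprod_gt0. Qed.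

Lemma qexp_ge0 k : (0 <= qexp k)%E.
Proof. by apply: nneseries_ge0 => m _ _; exact: term_ge0. Qed.

Lemma qexp_recl k :
  qexp k = (1 + \sum_(0 <= m <oo) (q ^+ (k.+1 * m.+1) / qp m.+1)%:E)%E.
Proof.
rewrite /qexp nneseries_recl //; congr (_ + _)%E.
  by rewrite muln0 expr0 /qprod big_geq // invr1 mulr1.
rewrite -(@nneseries_addn _ (fun m => (q ^+ (k.+1 * m) / qp m)%:E)) //.
by apply: eq_eseriesr => m _; rewrite addn1.
Qed.

(** Multiply the terms by [q^m + (1 - q^m)]; in the second part [1 - q^m] cancels
the last factor of [<m>_q]. *)
Lemma qexpS k : qexp k = (qexp k.+1 + (q ^+ k.+1)%:E * qexp k)%E.
Proof.
have -> : ((q ^+ k.+1)%:E * qexp k =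
    \sum_(0 <= m <oo) (q ^+ (k.+1 * m.+1) / qp m)%:E)%E.
  rewrite /qexp -nneseriesZl //; apply: eq_eseriesr => m _.
  by rewrite -EFinM mulrA -exprD mulnS.
rewrite !qexp_recl -addeA -nneseriesD //.
- congr (_ + _)%E; apply: eq_eseriesr => m _; rewrite -EFinD; congr (_%:E).
  rewrite qprodS (_ : k.+2 * m.+1 = k.+1 * m.+1 + m.+1)%N; last by lia.
  rewrite exprD; field.
  by rewrite lt0r_neq0 ?qprod_gt0 //= onem_expr_neq0.
- by move=> m _ _; rewrite lee_fin divr_ge0 // ?exprn_ge0 // ltW // qprod_gt0.
Qed.

Hypothesis fin0 : (qexp 0 < +oo)%E.

Lemma qexp_fin_num k : qexp k \is a fin_num.
Proof.
elim: k => [|k IH]; first by rewrite ge0_fin_numE // qexp_ge0.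
rewrite ge0_fin_numE ?qexp_ge0 //.
apply: (@le_lt_trans _ _ (qexp k)); last by rewrite -ge0_fin_numE ?qexp_ge0.
by rewrite [leRHS]qexpS leeDl // mule_ge0 ?qexp_ge0 // lee_fin exprn_ge0 // ltW.
Qed.

Definition rqexp k : R := fine (qexp k).

Lemma rqexpE k : qexp k = (rqexp k)%:E.
Proof. by rewrite fineK // qexp_fin_num. Qed.

Lemma rqexp_qprod k : rqexp k = qp k * rqexp 0.
Proof.
elim: k => [|k IH]; first by rewrite /qprod big_geq // mul1r.
have := qexpS k; rewrite !rqexpE -EFinM -EFinD => -[] H.
by rewrite qprodS mulrAC -IH mulrBr mulr1 {1}H mulrC addrK.
Qed.

(** For [m > 0], [q^((k+1)m) <= q^k q^m]. *)
Lemma rqexp_bounds k : 1 <= rqexp k <= 1 + q ^+ k * (rqexp 0 - 1).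
Proof.
have H (n : nat) :
    (\sum_(0 <= m <oo) (q ^+ (n.+1 * m.+1) / qp m.+1)%:E)%E = (rqexp n - 1)%:E.
  by rewrite EFinB -rqexpE qexp_recl addeAC subee // add0e.
have : (0 <= \sum_(0 <= m <oo) (q ^+ (k.+1 * m.+1) / qp m.+1)%:E)%E.
  by apply: nneseries_ge0 => m _ _; exact: term_ge0.
rewrite H lee_fin subr_ge0 => -> /=.
rewrite addrC -lerBlDr -lee_fin -H EFinM -H -nneseriesZl //.
apply: lee_nneseries => [m _ _|m _]; first exact: term_ge0.
rewrite -EFinM lee_fin mulrA -exprD ler_pM2r ?invr_gt0 ?qprod_gt0 //.
by rewrite ler_wiXn2l // ?ltW //; lia.
Qed.

Lemma cvg_rqexp : rqexp k @[k --> \oo] --> (1 : R).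
Proof.
apply: (@squeeze_cvgr _ _ _ _ (fun=> 1) (fun k => 1 + q ^+ k * (rqexp 0 - 1))).
- by near=> k; exact: rqexp_bounds.
- exact: cvg_cst.
rewrite -[X in _ --> X]addr0 -[X in _ --> _ + X](mul0r (rqexp 0 - 1)).
apply: cvgD; first exact: cvg_cst.
apply: cvgM; last exact: cvg_cst.
by apply: cvg_expr; rewrite gtr0_norm.
Unshelve. all: by end_near.
Qed.

Lemma rqexp0 : rqexp 0 * qprod_oo q = 1.
Proof.
have g0 : rqexp 0 != 0.
  by rewrite lt0r_neq0 // (lt_le_trans ltr01) //; case/andP: (rqexp_bounds 0).
suff -> : qprod_oo q = (rqexp 0)^-1 by rewrite divff.
apply: cvg_lim => //.
rewrite -[X in _ --> X]mul1r.
rewrite (_ : qprod q = (fun k => rqexp k * (rqexp 0)^-1)).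
  by apply: cvgM; [exact: cvg_rqexp | exact: cvg_cst].
by apply/funext => k; rewrite rqexp_qprod mulfK.
Qed.

Lemma sum_qweight :
  (\esum_(x in [set: nat * nat]) (qweight q x.1 x.2)%:E)%E =
  (rqexp 0 / (1 - q))%:E.
Proof.
have w0 k m : (0 <= (qweight q k m)%:E)%E by rewrite lee_fin qweight_ge0.
rewrite esum_nat2; last by move=> x; exact: w0.
transitivity (\sum_(0 <= k <oo) (rqexp 0 * q ^+ k)%:E)%E.
  apply: eq_eseriesr => k _.
  rewrite (@eq_eseriesl _ _ xpredT); last by move=> m; rewrite in_setT.
  transitivity ((q ^+ k / qp k)%:E * qexp k)%E.
    rewrite /qexp -nneseriesZl //; apply: eq_eseriesr => m _ /=.
    rewrite -EFinM /qweight (_ : _ + m = k + k.+1 * m)%N; last by lia.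
    rewrite exprD; congr (_%:E); field.
    by rewrite !lt0r_neq0 ?qprod_gt0.
  rewrite rqexpE rqexp_qprod -EFinM; congr (_%:E); field.
  by rewrite lt0r_neq0 ?qprod_gt0.
apply: cvg_lim => //; apply: cvg_EFin; first by near=> n; rewrite sumEFin.
rewrite (_ : _ \o _ = series (geometric (rqexp 0) q)).
  by apply: cvg_geometric_series; rewrite gtr0_norm.
by apply/funext => n /=; rewrite sumEFin.
Unshelve. all: by end_near.
Qed.

End q_series.

(** * The law of the displacement *)

Lemma probability_setI_full d (T : measurableType d) (R : realType)
    (Q : probability T R) (A B : set T) :
  measurable A -> measurable B -> Q B = 1%E -> Q (A `&` B) = Q A.
Proof.
move=> mA mB QB.
have QBC : Q (~` B) = 0%E by rewrite probability_setC // QB subee.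
have -> : Q A = (Q (A `\` B) + Q (A `&` B))%E by exact: measureDI.
rewrite (_ : Q (A `\` B) = 0%E) ?add0e //.
apply/eqP; rewrite eq_le measure_ge0 andbT -QBC.
apply: le_measure; rewrite ?inE; [exact: measurableD|exact: measurableC|].
by move=> x [].
Qed.

Section mallows.
Context {R : realType} (q : R).
Hypotheses (q0 : 0 < q) (q1 : q < 1).
Variable Q : probability permZ R.
Hypothesis Qm : is_mallows q Q.

Let c : R := pcross Q 0 0 0 0.
Let dcross j (x : nat * nat) := cross j (j + x.1%:Z - x.2%:Z) x.1 x.2.

Let c_ge0 : 0 <= c.
Proof. by rewrite /c /pcross fine_ge0 // measure_ge0. Qed.

Let mdcross j x : measurable (dcross j x). Proof. exact: measurable_cross. Qed.

Let tdcross j D : trivIset D (dcross j).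
Proof.
move=> [k m] [k' m'] _ _ [s [[/= <- bk am] [/= <- bk' am']]].
congr pair; apply/card_eq_II.
  by rewrite -(card_eql bk) bk'.
by rewrite -(card_eql am) am'.
Qed.

Lemma mallows_esum j D :
  (Q (\bigcup_(x in D) dcross j x) =
   c%:E * \esum_(x in D) (qweight q x.1 x.2)%:E)%E.
Proof.
case: Qm => _ Qr Ql.
rewrite measure_bigcup_nat2; [|exact: mdcross|exact: tdcross].
rewrite -esumZl_nat2 //; last by move=> x; rewrite lee_fin qweight_ge0.
apply: eq_esum => x _; apply: etrans (pcrossE _ _ _ _ _) _.
by rewrite (pcross_qweight Qr Ql q0 q1) EFinM.
Qed.

Let measurable_bigcup_cross j D : measurable (\bigcup_(x in D) dcross j x).
Proof.
rewrite bigcup_mkcond; apply: countable_bigcupT_measurable => // x.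
by case: ifP => // _; exact: mdcross.
Qed.

Lemma mallows_const : c = (1 - q) * qprod_oo q.
Proof.
have w0 (x : nat * nat) : (0 <= (qweight q x.1 x.2)%:E)%E.
  by rewrite lee_fin qweight_ge0.
have tot :
    (c%:E * (\esum_(x in [set: nat * nat]) (qweight q x.1 x.2)%:E) = 1)%E.
  case: Qm => Qb _ _.
  rewrite -(mallows_esum 0) -(probability_setI_full _ measurable_balanced Qb) //.
  rewrite setIidr // => s /(balanced_cross 0) [k [m kms]].
  by exists (k, m).
have c_neq0 : c != 0.
  apply/eqP => c0; move: tot; rewrite c0 mul0e => -[] /eqP.
  by rewrite eq_sym oner_eq0.
have c_gt0 : 0 < c by rewrite lt0r c_neq0.
have fin0 : (qexp q 0 < +oo)%E.
  (* the series is the part k = 0 of the total *)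
  apply: (@le_lt_trans _ _
    (\esum_(x in [set: nat * nat]) (qweight q x.1 x.2)%:E)%E).
    rewrite esum_nat2 // nneseries_recl //; last first.
      by move=> k _; apply: nneseries_ge0 => m _ _; exact: (w0 (k, m)).
    rewrite (_ : qexp q 0 = \sum_(0 <= m <oo | (0%N, m) \in [set: nat * nat])
        (qweight q 0 m)%:E)%E.
      rewrite leeDl //; apply: nneseries_ge0 => k _ _.
      by apply: nneseries_ge0 => m _ _; exact: (w0 (k, m)).
    rewrite (@eq_eseriesl _ _ xpredT); last by move=> m; rewrite in_setT.
    apply: eq_eseriesr => m _; rewrite /qweight !mul1n mul0n add0n.
    by rewrite [qprod q 0]/qprod big_geq // mul1r.
  rewrite ltey; apply/eqP => Eoo; move: tot.
  by rewrite Eoo gt0_muley // lte_fin.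
move: tot; rewrite (sum_qweight q0 q1 fin0) -EFinM => -[] cE.
have gq := rqexp0 q0 q1 fin0.
have g0 : rqexp q 0 != 0.
  by apply/eqP => g0; move/eqP: gq; rewrite g0 mul0r eq_sym oner_eq0.
have q10 : 1 - q != 0 by rewrite subr_eq0 eq_sym lt_eqF.
apply: (mulIf g0).
rewrite -mulrA [qprod_oo q * _]mulrC gq mulr1.
have -> : c * rqexp q 0 = c * (rqexp q 0 / (1 - q)) * (1 - q) by field.
by rewrite cE mul1r.
Qed.

Lemma mallows_displacement j d :
  Q [set s : permZ | s j - j = d] =
  (((1 - q) * qprod_oo q)%:E *
    \esum_(x in [set x : nat * nat | (x.1%:Z - x.2%:Z = d)%R])
      (qweight q x.1 x.2)%:E)%E.
Proof.
case: Qm => Qb _ _.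
rewrite -mallows_const -(mallows_esum j).
rewrite -(probability_setI_full _ measurable_balanced Qb); last first.
  exact: (measurable_evalP _ [set x | x - j = d]).
rewrite -[RHS](probability_setI_full _ measurable_balanced Qb) //.
congr (Q _); apply/seteqP; split => s [sd sb]; split => //.
  have [k [m kms]] := balanced_cross j sb; exists (k, m) => //.
  by case: kms sd => /= -> _ _; lia.
by case: sd => -[k m] /= kmd [/= -> _ _]; lia.
Qed.

End mallows.

Theorem theorem5p1 (R : realType) (q : R) (q_gt0 : 0 < q) (q_lt1 : q < 1)
  (dO : measure_display) (Omega : measurableType dO) (P : probability Omega R)
  (Sigma : {RV P >-> permZ})
  (Sigma_mallows : is_mallows q (distribution P Sigma)) (j d : int) :
  P [set w | (Sigma w : permZ) j - j = d] =
  (((1 - q) * qprod_oo q)%:E *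
    \esum_(rl in [set rl : nat * nat | (rl.1%:Z - rl.2%:Z = d)%R])
      (q ^+ (rl.1 * rl.2 + rl.1 + rl.2)%N /
        (qprod q rl.1 * qprod q rl.2))%:E)%E.
Proof. exact: (mallows_displacement q_gt0 q_lt1 Sigma_mallows j d). Qed.
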